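(* Let $r,n\ge 2$ be integers, let $\ell$ be the smallest prime divisor of $n$, and $$\epsilon_{r,n}(\mathbf{q})=\frac{\mathbf{q}^{\ell\left(\binom{r+n/\ell}{r}-1\right)}}{\ell(1-\mathbf{q}^{-\ell})}\in\mathbb{Q}(\mathbf{q}),\qquad \kappa=(\ell-1)\Bigl(\binom{r-1+n/\ell}{r-1}-r\Bigr)+1.$$ Then the following hold. (i) $\mathsf{E}_1(\mathbf{q})=0$. (ii) If $n$ is prime, then $$\mathsf{E}_n(\mathbf{q})=\epsilon_{r,n}(\mathbf{q})\,(1-\mathbf{q}^{-nr})\Bigl(1-\mathbf{q}^{-r(n-1)}\,\frac{(1-\mathbf{q}^{-r})(1-\mathbf{q}^{-n})}{(1-\mathbf{q}^{-1})(1-\mathbf{q}^{-nr})}\Bigr).$$ (iii) If $n$ is composite, then $\kappa\ge 2$ and $$\mathsf{E}_n(\mathbf{q})=\epsilon_{r,n}(\mathbf{q})\bigl(1+O(\mathbf{q}^{-\kappa})\bigr).$$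
   Context: $\mathbf{q}$ is an indeterminate. For fixed $r\ge2$ and $n\ge 0$ let $\mathsf{P}_n(\mathbf{q})=\mathbf{q}^{\binom{r+n}{r}-1}\frac{1-\mathbf{q}^{-\binom{r-1+n}{r-1}}}{1-\mathbf{q}^{-1}}\in\mathbb{Z}[\mathbf{q}]$ (so $\mathsf{P}_0=1$), and define in $\mathbb{Q}(\mathbf{q})[[z]]$ the power series $\mathsf{P}(\mathbf{q},z)=\sum_{n\ge0}\mathsf{P}_n(\mathbf{q})z^n$ and $\mathsf{I}(\mathbf{q},z)=\sum_{k\ge1}\frac{\mu(k)}{k}\log\mathsf{P}(\mathbf{q},z^k)$, where $\mu$ is the Möbius function and $\log(1-f)=-\sum_{i\ge1}f^i/i$ for $f$ with zero constant term. Let $\mathsf{I}_n(\mathbf{q})$ be the coefficient of $z^n$ in $\mathsf{I}(\mathbf{q},z)$. Put $\mathsf{A}_0=0$, $\mathsf{A}_n(\mathbf{q})=\sum_{k\mid n}\frac1k\sum_{s\mid k}\mu(s)\,\mathsf{I}_{n/k}(\mathbf{q}^s)$ for $n>0$, and $\mathsf{E}_n(\mathbf{q})=\mathsf{I}_n(\mathbf{q})-\mathsf{A}_n(\mathbf{q})$, so that $\mathsf{E}_n(\mathbf{q})=-\sum_{1<k\mid n}\frac1k\sum_{s\mid k}\mu(s)\,\mathsf{I}_{n/k}(\mathbf{q}^s)$ for $n\ge1$. For nonzero $f\in\mathbb{Q}(\mathbf{q})$, $\deg_{\mathbf{q}}f$ is the numerator degree minus the denominator degree. For a positive integer $m$ and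 fixed $r,n$, $O(\mathbf{q}^{-m})$ in an equation stands for some $f\in\mathbb{Q}(\mathbf{q})$ of degree at most $-m$ (possibly zero) that makes the equation valid. *)

(* Defs.v *)
From mathcomp Require Import all_boot all_order all_algebra.

Set Implicit Arguments.
Unset Strict Implicit.
Unset Printing Implicit Defensive.

Import Order.TTheory GRing.Theory Num.Theory.
Local Open Scope ring_scope.
Local Open Scope quotient_scope.

Definition Qq : fieldType := {fraction {poly rat}}.

Definition emb (p : {poly rat}) : Qq := FracField.tofrac p.

Definition q : Qq := emb 'X.

(* The degree of a nonzero rational function; it does not depend on the chosen
   representative (see [degqE]).  The value at 0 is irrelevant. *)
Definition degq (f : Qq) : int :=
  (size (\n_(repr f)))%:Z - (size (\d_(repr f)))%:Z.

(* [f] is one of the functions that O(q^(-m)) may stand for. *)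
Definition bigO_q (m : int) (f : Qq) : Prop := f = 0 \/ degq f <= - m.

(* f(q^s), for s > 0; it does not depend on the chosen representative
   (see [qsubstE]). *)
Definition qsubst (s : nat) (f : Qq) : Qq :=
  emb (\n_(repr f) \Po 'X^s) / emb (\d_(repr f) \Po 'X^s).

Definition mobius (n : nat) : int :=
  if (0 < n)%N && all (fun p => logn p n == 1%N) (primes n)
  then (-1) ^+ size (primes n) else 0.

(* Formal power series in z over Q(q), as sequences of coefficients. *)
Definition fps : Type := nat -> Qq.

Definition fps1 : fps := fun n => (n == 0%N)%:R.

Definition fps_sub (f g : fps) : fps := fun n => f n - g n.

Definition fps_mul (f g : fps) : fps :=
  fun n => \sum_(i < n.+1) f i * g (n - i)%N.

Definition fps_exp (f : fps) (i : nat) : fps := iter i (fps_mul f) fps1.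

(* f(z^k), for k > 0. *)
Definition fps_dilate (k : nat) (f : fps) : fps :=
  fun n => if (k %| n)%N then f (n %/ k)%N else 0.

(* log g = - \sum_(i >= 1) (1 - g)^i / i, for g with constant term 1: the terms
   i > n do not contribute to the coefficient of z^n (see [fps_exp_small]). *)
Definition fps_log (g : fps) : fps :=
  fun n => - \sum_(1 <= i < n.+1) fps_exp (fps_sub fps1 g) i n / i%:R.

Definition P_ (r : nat) : fps := fun n =>
  q ^ ('C(r + n, r)%:Z - 1) * (1 - q ^- 'C(r - 1 + n, r - 1)) / (1 - q^-1).

(* I = \sum_(k >= 1) mu(k) / k * log P(q, z^k): the terms k > n do not
   contribute to the coefficient of z^n (see [fps_log_dilate_small]). *)
Definition I_ (r : nat) : fps := fun n =>
  \sum_(1 <= k < n.+1)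
    (mobius k)%:~R / k%:R * fps_log (fps_dilate k (P_ r)) n.

Definition A_ (r n : nat) : Qq :=
  if n == 0%N then 0 else
  \sum_(k <- divisors n)
    k%:R^-1 * \sum_(s <- divisors k) (mobius s)%:~R * qsubst s (I_ r (n %/ k)%N).

Definition E_ (r n : nat) : Qq := I_ r n - A_ r n.

(* For n >= 2, [pdiv n] is the smallest prime divisor of n. *)
Definition epsilon (r n : nat) : Qq :=
  let l := pdiv n in
  q ^ (l%:Z * ('C(r + n %/ l, r)%:Z - 1)) / (l%:R * (1 - q ^- l)).

Definition kappa (r n : nat) : int :=
  let l := pdiv n in
  (l%:Z - 1) * ('C(r - 1 + n %/ l, r - 1)%:Z - r%:Z) + 1.

Lemma emb_repr (f : Qq) : f * emb (\d_(repr f)) = emb (\n_(repr f)).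
Proof.
rewrite /emb -[X in X * _ = _]reprK; set x := repr f.
unlock FracField.tofrac; rewrite -[LHS]FracField.pi_mul.
apply/eqmodP; rewrite /= FracField.equivfE /FracField.mulf.
by rewrite !numden_Ratio ?mulf_neq0 ?oner_eq0 ?denom_ratioP // !mulr1 mulrC.
Qed.

Lemma repr_cross (a b : {poly rat}) : b != 0 ->
  \n_(repr (emb a / emb b : Qq)) * b = a * \d_(repr (emb a / emb b : Qq)).
Proof.
move=> b0; set f : Qq := emb a / emb b; have := emb_repr f.
have eb0 : emb b != 0 by rewrite /emb tofrac_eq0.
move=> /(congr1 (fun x => x * emb b)); rewrite {1}/f mulrAC divfK //.
by rewrite /emb -!tofracM => /eqP; rewrite tofrac_eq => /eqP.
Qed.

Lemma degqE (a b : {poly rat}) : a != 0 -> b != 0 ->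
  degq (emb a / emb b) = (size a)%:Z - (size b)%:Z.
Proof.
move=> a0 b0; have e := repr_cross a b0; rewrite /degq.
set x := repr _ in e *; have d0 : \d_x != 0 by apply: denom_ratioP.
have n0 : \n_x != 0.
  by apply: contra_eq_neq e => ->; rewrite mul0r eq_sym mulf_neq0.
have := congr1 (fun p : {poly rat} => size p) e.
rewrite !size_mul //=; move: a0 b0 d0 n0; rewrite -!size_poly_gt0.
case: (size a) => // i _; case: (size b) => // j _.
case: (size \d_x) => // k _; case: (size \n_x) => // l _.
rewrite !addSn !addnS /= => h; apply/eqP.
by rewrite subr_eq addrAC eq_sym subr_eq -!PoszD !addSn !addnS h.
Qed.

Lemma qsubstE (s : nat) (a b : {poly rat}) : (0 < s)%N -> b != 0 ->
  qsubst s (emb a / emb b) = emb (a \Po 'X^s) / emb (b \Po 'X^s).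
Proof.
move=> s0 b0; have e := repr_cross a b0; rewrite /qsubst.
set x := repr _ in e *.
have nz p : p != 0 -> emb (p \Po 'X^s) != 0.
  by rewrite /emb tofrac_eq0 comp_poly_eq0 // size_polyXn.
apply/eqP; rewrite eqr_div ?nz // ?denom_ratioP //.
by rewrite /emb -!tofracM -!comp_polyM e.
Qed.

Lemma fps_exp_small (f : fps) (i n : nat) :
  f 0%N = 0 -> (n < i)%N -> fps_exp f i n = 0.
Proof.
move=> f0; elim: i n => // i IH n lt_ni.
rewrite /= /fps_mul big1 // => j _; case: (posnP j) => [->|j0].
  by rewrite f0 mul0r.
rewrite IH ?mulr0 //; apply: (@leq_trans n) => //.
by rewrite ltn_subrL j0 (leq_trans j0) // -ltnS.
Qed.

Lemma fps_log_dilate_small (g : fps) (k n : nat) :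
  g 0%N = 1 -> (0 < n < k)%N -> fps_log (fps_dilate k g) n = 0.
Proof.
move=> g0 /andP[n0 nk]; rewrite /fps_log big_nat big1 ?oppr0 // => i /andP[i0 _].
case: i i0 => // i _; rewrite /= /fps_mul big1 ?mul0r // => j _.
rewrite /fps_sub /fps1 /fps_dilate; case: (posnP j) => [->|j0].
  by rewrite dvdn0 div0n g0 subrr mul0r.
have jk : (j < k)%N by apply: leq_ltn_trans nk; rewrite -ltnS.
by rewrite gtnNdvd // subrr mul0r.
Qed.

Lemma P_0 (r : nat) : P_ r 0%N = 1.
Proof.
rewrite /P_ !addn0 !binn subrr expr0z mul1r expr1 divff // subr_eq0 eq_sym.
rewrite invr_eq1 /q /emb -tofrac1 tofrac_eq -subr_eq0 -size_poly_eq0.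
by rewrite -polyC1 size_XsubC.
Qed.

(* Main.v *)
Require Import Defs.
From mathcomp Require Import all_boot all_order all_algebra.
From mathcomp Require Import zify ring.

(* Write d_n = C(r+n,r) - 1 for the degree of P_n and c_n = d_n - d_(n-1)
   = C(r-1+n,r-1), a convex sequence in n.  Convexity makes d superadditive in
   the sense d_i + d_j <= d_(i+j-1) + d_1 for i, j >= 1, so that every product
   in the expansion of log P has degree at most d_(n-1) + d_1, and
   I_n = P_n + O(q^(d_(n-1) + d_1)).  In E_n the summand k = s = l contributes
   P_m(q^l) / l with m = n / l, which is epsilon * (1 - q^(-l c_m)).  The other
   summands have degree at most k d_(n/k), and since the average of
   c_1, ..., c_j is at most (c_1 + c_j) / 2, the gap l d_m - k d_(n/k) is at
   least kappa for every divisor k > l of n. *)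

Set Implicit Arguments.
Unset Strict Implicit.
Unset Printing Implicit Defensive.

Import Order.TTheory GRing.Theory Num.Theory.
Local Open Scope ring_scope.

(** * Binomial degrees *)

Section Binomials.
Local Open Scope nat_scope.

(* [dimP r n] is the degree of [P_ r n], and [nforms r n] its increment. *)
Definition nforms (r n : nat) := 'C(r - 1 + n, r - 1).
Definition dimP (r n : nat) := 'C(r + n, r) - 1.

Lemma nformsSS r n : 0 < r -> nforms r.+1 n.+1 = nforms r.+1 n + nforms r n.+1.
Proof.
case: r => // r _; rewrite /nforms !subn1 /= addnS binS addnC.
by rewrite addSnnS addnC.
Qed.

Lemma nforms1 r : 0 < r -> nforms r 1 = r.
Proof. by case: r => // r _; rewrite /nforms subn1 /= addn1 binSn. Qed.

Lemma nforms_gt0 r n : 0 < nforms r n.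
Proof. by rewrite /nforms bin_gt0 leq_addr. Qed.

Lemma nforms_ltS r n : 1 < r -> nforms r n < nforms r n.+1.
Proof.
by case: r => [|[|r]] // _; rewrite nformsSS // -[X in X < _]addn0 ltn_add2l nforms_gt0.
Qed.

Lemma nforms_leS r n : 0 < r -> nforms r n <= nforms r n.+1.
Proof.
case: r => [|[|r]] // _; last by rewrite ltnW ?nforms_ltS.
by rewrite /nforms !bin0.
Qed.

Lemma nforms_le r m n : 0 < r -> m <= n -> nforms r m <= nforms r n.
Proof. by move=> r0; apply: (homo_leq leqnn leq_trans) => i; apply: nforms_leS. Qed.

Lemma nforms_lt r m n : 1 < r -> m < n -> nforms r m < nforms r n.
Proof. by move=> r0; apply: (homo_ltn ltn_trans) => i; apply: nforms_ltS. Qed.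

(** By Pascal's rule ([nformsSS]) the increments of c are values of the same sequence for [r - 1],
    which is nondecreasing. *)
Lemma nforms_convex r n : 1 < r ->
  nforms r n.+1 + nforms r n.+1 <= nforms r n + nforms r n.+2.
Proof.
case: r => [|[|r]] // _.
have := @nforms_leS r.+1 n.+1 isT.
rewrite (@nformsSS r.+1 n.+1) // (@nformsSS r.+1 n) //; lia.
Qed.

(** At j the sequence c lies below its chord from 1 to j + 1; this is that bound times j, arranged
    without subtraction. In this form it is the induction step of [dimP_trapezoid]. *)
Lemma nforms_chord r j : 1 < r -> 0 < j ->
  nforms r j.+1 + j * nforms r j <= j * nforms r j.+1 + nforms r 1.
Proof.
move=> r1; case: j => // j _; elim: j => [|j IH]; first by lia.
have := leq_mul (leqnn j.+1) (@nforms_convex r j.+1 r1).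
move: IH; rewrite !mulnDr !mulSn; lia.
Qed.

Lemma dimPS r n : 0 < r -> dimP r n.+1 = dimP r n + nforms r n.+1.
Proof.
case: r => // r _; rewrite /dimP /nforms addnS binS subn1 /= addSnnS.
have : 0 < 'C(r + n.+1, r.+1) by rewrite -addSnnS bin_gt0 leq_addr.
rewrite !subn1 /=; lia.
Qed.

Lemma dimP0 r : dimP r 0 = 0.
Proof. by rewrite /dimP addn0 binn. Qed.

Lemma dimP1 r : 0 < r -> dimP r 1 = r.
Proof. by move=> r0; rewrite dimPS // dimP0 nforms1. Qed.

Lemma dimP_le r m n : 0 < r -> m <= n -> dimP r m <= dimP r n.
Proof.
move=> r0; apply: (homo_leq leqnn leq_trans) => i.
by rewrite dimPS ?leq_addr.
Qed.

(* A convex sequence lies below its chord, and so does its average. *)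
Lemma dimP_trapezoid r j : 1 < r ->
  (dimP r j).*2 <= j * (nforms r 1 + nforms r j).
Proof.
move=> r1; have r0 := ltnW r1; elim: j => [|j IH]; first by rewrite dimP0.
rewrite dimPS //; case: (posnP j) IH => [->|j0] IH; first by rewrite dimP0; lia.
have := nforms_chord r1 j0; move: IH; rewrite !mulnDr !mulSn; lia.
Qed.

(** Equality holds for i = 0, and raising i by one adds c_(i+2) on the left but c_(i+j+2), which is
    no smaller, on the right. *)
Lemma dimP_superadditive r i j : 0 < r ->
  dimP r i.+1 + dimP r j.+1 <= dimP r (i + j).+1 + dimP r 1.
Proof.
move=> r0; elim: i => [|i IH]; first by rewrite add0n addnC.
rewrite addSn !(@dimPS r _.+1) //.
have := @nforms_le r i.+2 (i + j).+2 r0; lia.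
Qed.

Lemma dimP_pred r n : 0 < r -> 0 < n -> dimP r n.-1 + dimP r 1 <= dimP r n.
Proof.
by case: n => // n r0 _; rewrite /= (dimPS n) // leq_add2l dimPS // dimP0 nforms_le.
Qed.

(** The difference d_m - d_j is c_(j+1) + ... + c_m; the last term is kept and each of the m - j - 1
    others is bounded below by c_j. *)
Lemma dimP_sub r m j : 0 < r -> j < m ->
  dimP r j + (m - j - 1) * nforms r j + nforms r m <= dimP r m.
Proof.
move=> r0; elim: m => // m IH; rewrite ltnS leq_eqVlt => /predU1P[<-|jm].
  by rewrite subSnn subnn dimPS // mul0n addn0.
have := IH jm; have -> : m.+1 - j - 1 = (m - j - 1).+1 by lia.
have := @nforms_le r j m r0 (ltnW jm); rewrite dimPS // mulSn.
lia.
Qed.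

(** With j = n / k the gap is l (d_m - d_j) - (k - l) d_j. [dimP_sub] bounds the first part below
    and [dimP_trapezoid] bounds d_j above; since k j = l m, the two bounds can be compared. *)
Lemma dimP_divisor_gap r n k (l := pdiv n) (m := n %/ l) :
  1 < r -> 1 < n -> k %| n -> l < k ->
  k * dimP r (n %/ k) + (l - 1) * (nforms r m - r) + 1 <= l * dimP r m.
Proof.
move=> r1 n1 kn lk; have r0 := ltnW r1.
have ln : l %| n by apply: pdiv_dvd.
have lP : prime l by apply: pdiv_prime.
have l1 := prime_gt1 lP; set j := n %/ k.
have ml : m * l = n by rewrite divnK.
have jk : j * k = n by rewrite divnK.
have j0 : 0 < j by case: (posnP j) jk n1 => // -> <-.
have jm : j < m.
  rewrite ltnNge; apply/negP => /leq_mul/(_ lk).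
  rewrite mulnS ml jk -[X in _ <= X]add0n leq_add2r leqn0 => /eqP m0.
  by rewrite -ml m0 in n1.
(* One of two consecutive divisors m, j of n is even, so the smallest prime divisor is 2. *)
have l2 : m - j = 1 -> l = 2.
  move=> e; apply/eqP; rewrite eqn_leq l1 andbT pdiv_min_dvd //.
  have : 2 %| m * j.
    have -> : m = j.+1 by lia.
    by rewrite dvdn2 oddM /=; case: (odd j).
  rewrite Euclid_dvdM // => /orP[] h; apply: dvdn_trans h _.
    by rewrite -ml dvdn_mulr.
  by rewrite -jk dvdn_mulr.
have hs := leq_mul (leqnn l) (dimP_sub r0 jm).
have ht := leq_mul (leqnn (k - l)) (dimP_trapezoid j r1).
have hmj := nforms_lt r1 jm.
have h1j : nforms r 1 <= nforms r j by apply: nforms_le.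
rewrite nforms1 // in ht h1j.
(* Both sides equal n - l j. *)
have e : (k - l) * j = l * (m - j) by rewrite mulnBl mulnBr; lia.
have {}ht : (k - l) * (dimP r j).*2 <= l * (m - j) * (r + nforms r j).
  by rewrite -e -mulnA.
have -> : k * dimP r j = l * dimP r j + (k - l) * dimP r j.
  by rewrite -mulnDl subnKC // ltnW.
(* Successor forms replace the truncated differences, so that the final comparison is free of
   them. *)
have [w cmE] : exists w, nforms r m = r + w.+1.
  by exists (nforms r m - r - 1); lia.
have [p lE] : exists p, l = p.+1 by exists l.-1; lia.
have [u jE] : exists u, m - j = u.+1 by exists (m - j - 1); lia.
rewrite -/j in hs *; rewrite jE in l2 hs ht *; rewrite cmE in hmj hs *.
rewrite subSS subn0 in hs; move: hs ht hmj h1j l2; rewrite {}lE {cmE jE e}.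
move: (dimP r j) (dimP r m) (nforms r j) (k - _) => dj dm cj t.
(* If m = j + 1, then l = 2 and c_j < c_m supplies the final 1. Otherwise c_j >= r brings the lower
   bound down to l (c_m - r), and c_m > r suffices. *)
case: u => [|u] hs ht hmj h1j l2.
  by move: hs ht; have -> : p = 1 by [have := l2 erefl; lia]; lia.
have := leq_mul (leqnn (p.+1 * u)) h1j.
move: hs ht; rewrite addKn subn1 /= -!muln2 !(mulSn, mulnDl, mulnDr, mulnS).
lia.
Qed.
End Binomials.

(** * Degrees and substitution in Q(q) *)

Lemma emb_eq0 p : (emb p == 0) = (p == 0).
Proof. by rewrite /emb tofrac_eq0. Qed.

Lemma embD p s : emb (p + s) = emb p + emb s.
Proof. exact: tofracD. Qed.

Lemma embN p : emb (- p) = - emb p.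
Proof. exact: tofracN. Qed.

Lemma embM p s : emb (p * s) = emb p * emb s.
Proof. exact: tofracM. Qed.

Lemma embX p n : emb (p ^+ n) = emb p ^+ n.
Proof. exact: tofracXn. Qed.

Lemma emb0 : emb 0 = 0.
Proof. exact: tofrac0. Qed.

Lemma emb1 : emb 1 = 1.
Proof. exact: tofrac1. Qed.

Lemma emb_nat n : emb n%:R = n%:R.
Proof. by elim: n => [|n IH]; rewrite ?emb0 // -addn1 !natrD embD IH emb1. Qed.

Lemma q_neq0 : q != 0.
Proof. by rewrite emb_eq0 polyX_eq0. Qed.

Lemma natQq_neq0 n : (0 < n)%N -> n%:R != 0 :> Qq.
Proof.
move=> n0; rewrite -emb_nat emb_eq0 -(rmorph_nat (@polyC rat)) polyC_eq0.
by rewrite pnatr_eq0 -lt0n.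
Qed.

Lemma Xn_sub1_neq0 n : (0 < n)%N -> 'X^n - 1 != 0 :> {poly rat}.
Proof. by move=> n0; rewrite monic_neq0 // monicXnsubC. Qed.

Lemma one_sub_qN n : 1 - q ^- n = emb ('X^n - 1) / emb 'X^n.
Proof.
have X0 : q ^+ n != 0 by rewrite expf_neq0 ?q_neq0.
by rewrite embD embN emb1 embX -/q mulrBl divff // mul1r.
Qed.

Lemma one_sub_qN_neq0 n : (0 < n)%N -> 1 - q ^- n != 0.
Proof.
move=> n0; rewrite one_sub_qN mulf_neq0 ?invr_eq0 ?emb_eq0 ?Xn_sub1_neq0 //.
by rewrite monic_neq0 ?monicXn.
Qed.

Lemma QqP (f : Qq) : exists a b : {poly rat}, b != 0 /\ f = emb a / emb b.
Proof.
exists (\n_(repr f)), (\d_(repr f)); split; first exact: denom_ratioP.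
by rewrite -emb_repr mulfK // emb_eq0 denom_ratioP.
Qed.

(** * Calculus of degree bounds *)

Lemma bigO_frac (m : int) (a b : {poly rat}) : b != 0 ->
  (size a)%:Z + m <= (size b)%:Z -> bigO_q m (emb a / emb b).
Proof.
move=> b0 h; have [->|a0] := eqVneq a 0; first by left; rewrite emb0 mul0r.
by right; rewrite degqE //; lia.
Qed.

(** The offset between size and degree cancels in a fraction. The case [a = 0] stays apart, because
    size 0 does not give the inequality for large [m]. *)
Lemma bigO_fracP (m : int) (f : Qq) : bigO_q m f ->
  exists a b : {poly rat}, [/\ b != 0, f = emb a / emb b
     & a = 0 \/ (size a)%:Z + m <= (size b)%:Z].
Proof.
have [a [b [b0 ->]]] := QqP f; exists a, b; split=> //.
have [->|a0] := eqVneq a 0; first by left.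
case: H => [/eqP|]; last by rewrite degqE // => h; right; lia.
by rewrite mulf_eq0 invr_eq0 !emb_eq0 (negPf a0) (negPf b0).
Qed.

Lemma bigO0 m : bigO_q m 0.
Proof. by left. Qed.

Lemma bigO_le m m' f : m' <= m -> bigO_q m f -> bigO_q m' f.
Proof. by move=> h [->|h']; [left|right; lia]. Qed.

Lemma bigON m f : bigO_q m f -> bigO_q m (- f).
Proof.
move=> /bigO_fracP[a [b [b0 -> h]]]; rewrite -mulNr -embN.
case: h => [->|h]; first by rewrite oppr0 emb0 mul0r; left.
by apply: bigO_frac; rewrite ?size_polyN.
Qed.

Lemma bigOD m f g : bigO_q m f -> bigO_q m g -> bigO_q m (f + g).
Proof.
move=> /bigO_fracP[a [b [b0 -> [->|h]]]].
  by rewrite emb0 mul0r add0r.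
move=> /bigO_fracP[a' [b' [b'0 -> [->|h']]]].
  by rewrite emb0 mul0r addr0; apply: bigO_frac.
rewrite addf_div ?emb_eq0 // -!embM -embD; apply: bigO_frac.
  by rewrite mulf_neq0.
have := size_polyD (a * b') (a' * b).
have := size_polyMleq a b'; have := size_polyMleq a' b.
rewrite (size_mul b0 b'0).
move: b0 b'0; rewrite -!size_poly_gt0.
move: h h'; move: (size a) (size b) (size a') (size b'); lia.
Qed.

Lemma bigOB m f g : bigO_q m f -> bigO_q m g -> bigO_q m (f - g).
Proof. by move=> hf /bigON; apply: bigOD. Qed.

Lemma bigOM m m' f g : bigO_q m f -> bigO_q m' g -> bigO_q (m + m') (f * g).
Proof.
move=> /bigO_fracP[a [b [b0 -> [->|h]]]].
  by rewrite emb0 !mul0r; left.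
move=> /bigO_fracP[a' [b' [b'0 -> [->|h']]]].
  by rewrite emb0 mul0r mulr0; left.
have [->|a0] := eqVneq a 0; first by rewrite emb0 !mul0r; left.
have [->|a'0] := eqVneq a' 0; first by rewrite emb0 mul0r mulr0; left.
rewrite mulf_div -!embM; apply: bigO_frac; first by rewrite mulf_neq0.
rewrite (size_mul b0 b'0) (size_mul a0 a'0).
move: b0 b'0 a0 a'0; rewrite -!size_poly_gt0.
move: h h'; move: (size a) (size b) (size a') (size b'); lia.
Qed.

Lemma bigO_sum (I : eqType) (s : seq I) (P : pred I) m (F : I -> Qq) :
  (forall i, i \in s -> P i -> bigO_q m (F i)) ->
  bigO_q m (\sum_(i <- s | P i) F i).
Proof.
move=> h; rewrite big_seq_cond; elim/big_rec: _ => [|i x /andP[si Pi] hx].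
  exact: bigO0.
by apply: bigOD => //; apply: h.
Qed.

Lemma bigO_nat n : bigO_q 0 n%:R.
Proof.
rewrite -emb_nat -[emb _]divr1 -emb1; apply: bigO_frac; rewrite ?oner_eq0 //.
rewrite size_poly1 addr0 -(rmorph_nat (@polyC rat)) size_polyC; lia.
Qed.

Lemma bigO_natV n : bigO_q 0 n%:R^-1.
Proof.
(* The inverse of 0 is 0 by convention, so the bound also covers [n = 0]. *)
case: (posnP n) => [->|n0]; first by rewrite invr0; left.
have h := natQq_neq0 n0; rewrite -emb_nat -[_^-1]mul1r -emb1; apply: bigO_frac.
  by rewrite -emb_eq0 emb_nat.
rewrite size_poly1 addr0 -(rmorph_nat (@polyC rat)) size_polyC.
by rewrite pnatr_eq0 -lt0n n0.
Qed.

Lemma bigO_int (z : int) : bigO_q 0 z%:~R.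
Proof. by case: z => n; rewrite ?NegzE ?mulrNz; [|apply: bigON]; apply: bigO_nat. Qed.

Lemma bigO_qX (z : int) : bigO_q (- z) (q ^ z).
Proof.
case: z => n; rewrite ?NegzE -?exprnN ?exprz_inv.
  rewrite -exprnP -embX -[emb _]divr1 -emb1; apply: bigO_frac; rewrite ?oner_eq0 //.
  by rewrite size_polyXn size_poly1; lia.
rewrite -embX -[_^-1]mul1r -emb1; apply: bigO_frac.
  by rewrite monic_neq0 ?monicXn.
by rewrite size_polyXn size_poly1; lia.
Qed.

Lemma bigO_one_sub_qN n : bigO_q 0 (1 - q ^- n).
Proof.
apply: bigOB; first exact: (bigO_nat 1).
by rewrite exprnN; apply: bigO_le (bigO_qX _); lia.
Qed.

(** The inverse is X^n / (X^n - 1), with numerator and denominator of equal size. *)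
Lemma bigO_one_sub_qNV n : (0 < n)%N -> bigO_q 0 (1 - q ^- n)^-1.
Proof.
move=> n0; rewrite one_sub_qN invf_div; apply: bigO_frac.
  exact: Xn_sub1_neq0.
by rewrite size_polyXn size_XnsubC // addr0.
Qed.

(** * The substitution of q^s for q *)

Lemma comp_Xn_neq0 (b : {poly rat}) s : (0 < s)%N -> b != 0 -> b \Po 'X^s != 0.
Proof. by move=> s0 b0; rewrite comp_poly_eq0 // size_polyXn. Qed.

Lemma qsubst1 f : qsubst 1 f = f.
Proof.
have [a [b [b0 ->]]] := QqP f.
by rewrite qsubstE // !comp_polyXr.
Qed.

Lemma qsubst_emb s p : (0 < s)%N -> qsubst s (emb p) = emb (p \Po 'X^s).
Proof.
move=> s0; rewrite -[emb p in LHS]divr1 -emb1 qsubstE ?oner_eq0 //.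
by rewrite -polyC1 comp_polyC polyC1 emb1 divr1.
Qed.

Lemma qsubstM s : (0 < s)%N -> {morph qsubst s : f g / f * g}.
Proof.
move=> s0 f g; have [a [b [b0 ->]]] := QqP f; have [a' [b' [b'0 ->]]] := QqP g.
by rewrite mulf_div -!embM !qsubstE ?mulf_neq0 // !comp_polyM !embM mulf_div.
Qed.

Lemma qsubstD s : (0 < s)%N -> {morph qsubst s : f g / f + g}.
Proof.
move=> s0 f g; have [a [b [b0 ->]]] := QqP f; have [a' [b' [b'0 ->]]] := QqP g.
rewrite addf_div ?emb_eq0 // -!embM -embD !qsubstE ?mulf_neq0 //.
by rewrite comp_polyD !comp_polyM embD !embM addf_div ?emb_eq0 ?comp_Xn_neq0.
Qed.

Lemma qsubst_one_sub_qN s n : (0 < s)%N ->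
  qsubst s (1 - q ^- n) = 1 - q ^- (s * n).
Proof.
move=> s0; rewrite !one_sub_qN qsubstE //; last by rewrite monic_neq0 ?monicXn.
by rewrite comp_polyB -polyC1 comp_polyC polyC1 comp_Xn_poly -exprM.
Qed.

Lemma qsubstV s : (0 < s)%N -> {morph qsubst s : f / f^-1}.
Proof.
move=> s0 f; have [a [b [b0 ->]]] := QqP f.
have [->|a0] := eqVneq a 0.
  by rewrite emb0 mul0r invr0 -emb0 qsubst_emb // comp_poly0 emb0 invr0.
by rewrite invf_div !qsubstE // invf_div.
Qed.

Lemma bigO_qsubst s m f : (0 < s)%N -> bigO_q m f -> bigO_q (s%:Z * m) (qsubst s f).
Proof.
move=> s0 /bigO_fracP[a [b [b0 -> h]]].
have [->|a0] := eqVneq a 0.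
  by rewrite emb0 mul0r -emb0 qsubst_emb // comp_poly0 emb0; left.
case: h => [/eqP|h]; first by rewrite (negPf a0).
rewrite qsubstE //; apply: bigO_frac; first exact: comp_Xn_neq0.
(* [size_comp_poly] relates only predecessors of sizes, so both composites must be known to be
   nonzero. *)
have := size_comp_poly a 'X^s; have := size_comp_poly b 'X^s.
have := comp_Xn_neq0 s0 b0; have := comp_Xn_neq0 s0 a0.
rewrite size_polyXn /=; move: a0 b0 h; rewrite -!size_poly_gt0.
case: (size a) => // i _; case: (size b) => // j _ h.
case: (size _) => // i' _; case: (size _) => // j' _ /= -> ->.
have : s%:Z * (i%:Z + m) <= s%:Z * j%:Z by rewrite ler_wpM2l //; lia.
rewrite mulrDr; lia.
Qed.

(** * Degrees of the coefficients of I and E *)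

Lemma dimPz r n : 'C(r + n, r)%:Z - 1 = (dimP r n)%:Z.
Proof.
have : (0 < 'C(r + n, r))%N by rewrite bin_gt0 leq_addr.
rewrite /dimP; lia.
Qed.

Lemma P_E r n :
  P_ r n = q ^+ dimP r n * (1 - q ^- nforms r n) / (1 - q ^- 1).
Proof.
by rewrite /P_ expr1 dimPz.
Qed.

Lemma qsubst_P s r n : (0 < s)%N ->
  qsubst s (P_ r n) =
    q ^+ (s * dimP r n) * (1 - q ^- (s * nforms r n)) / (1 - q ^- s).
Proof.
move=> s0; rewrite P_E !qsubstM // qsubstV // !qsubst_one_sub_qN // muln1.
by rewrite -embX qsubst_emb // comp_Xn_poly -exprM embX.
Qed.

Lemma bigO_P r n : bigO_q (- (dimP r n)%:Z) (P_ r n).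
Proof.
rewrite P_E -[- _]addr0 -[X in bigO_q X]addr0.
by apply/bigOM/bigO_one_sub_qNV/isT/bigOM/bigO_one_sub_qN/bigO_qX.
Qed.

(** * Powers and logarithms of power series *)

Lemma fps_exp1 (f : fps) n : fps_exp f 1 n = f n.
Proof.
rewrite /= /fps_mul big_ord_recr /= subnn /fps1 eqxx mulr1 big1 ?add0r //.
by move=> i _; rewrite eqn0Ngt subn_gt0 ltn_ord mulr0.
Qed.

Section PowerSeriesBounds.
Variables (r : nat) (f : fps).
Hypotheses (r0 : (0 < r)%N) (f0 : f 0%N = 0).
Hypothesis fO : forall n, bigO_q (- (dimP r n)%:Z) (f n).

(** To be applied to f = 1 - P(q, z^k). Constant terms vanish, so only products of two coefficients
    with positive indices of sum n remain, and [dimP_superadditive] bounds their degrees. *)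
Lemma bigO_fps_expS i n :
  (forall m, bigO_q (- (dimP r m)%:Z) (fps_exp f i.+1 m)) ->
  bigO_q (- (dimP r n.-1 + dimP r 1)%:Z) (fps_exp f i.+2 n).
Proof.
move=> IH; rewrite [fps_exp _ _]iterS -/(fps_exp f i.+1).
apply: bigO_sum => -[j jn] _ _; rewrite [nat_of_ord _]/=.
case: j jn => [|j] jn.
  by rewrite f0 mul0r; apply: bigO0.
have [nj|jn'] := leqP n j.+1.
  have -> : (n - j.+1)%N = 0%N by lia.
  by rewrite fps_exp_small // mulr0; apply: bigO0.
apply: bigO_le (bigOM (fO _) (IH _)).
have -> : (n - j.+1 = (n - j.+2).+1)%N by lia.
have := @dimP_superadditive r j (n - j.+2) r0.
have -> : ((j + (n - j.+2)).+1 = n.-1)%N by lia.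
lia.
Qed.

Lemma bigO_fps_exp i n : bigO_q (- (dimP r n)%:Z) (fps_exp f i.+1 n).
Proof.
elim: i n => [|i IH] n; first by rewrite fps_exp1.
(* At n = 0, where [n.-1] is 0, the bound d_0 + d_1 would be too weak. *)
case: (posnP n) => [->|n0]; first by rewrite fps_exp_small //; apply: bigO0.
apply: bigO_le (bigO_fps_expS n IH).
by have := dimP_pred r0 n0; lia.
Qed.

Lemma bigO_fps_exp_ge2 i n : (1 < i)%N ->
  bigO_q (- (dimP r n.-1 + dimP r 1)%:Z) (fps_exp f i n).
Proof. by case: i => [|[|i]] // _; apply/bigO_fps_expS/bigO_fps_exp. Qed.

End PowerSeriesBounds.

Lemma dilate1 f n : fps_dilate 1 f n = f n.
Proof. by rewrite /fps_dilate dvd1n divn1. Qed.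

(** For n > 0 the term i = 1 of the logarithm is the coefficient of P(q, z^k) itself; the terms i >=
    2 fall under [bigO_fps_exp_ge2]. *)
Lemma bigO_log_dilate_P r k n : (0 < r)%N -> (0 < k)%N -> (0 < n)%N ->
  bigO_q (- (dimP r n.-1 + dimP r 1)%:Z)
    (fps_log (fps_dilate k (P_ r)) n - fps_dilate k (P_ r) n).
Proof.
move=> r0 k0 n0; set f := fps_dilate _ _.
pose g := fps_sub fps1 f.
have g0 : g 0%N = 0.
  by rewrite /g /f /fps_sub /fps1 /fps_dilate dvdn0 div0n P_0 subrr.
(* Dilation moves P_(j/k) to index j, and d_(j/k) <= d_j. *)
have gO j : bigO_q (- (dimP r j)%:Z) (g j).
  case: (posnP j) => [->|j0]; first by rewrite g0; apply: bigO0.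
  rewrite /g /f /fps_sub /fps1 /fps_dilate eqn0Ngt j0 sub0r; apply: bigON.
  case: ifP => _; last exact: bigO0.
  apply: bigO_le (bigO_P _ _).
  by have := dimP_le r0 (leq_div j k); lia.
have -> : fps_log f n - f n =
    - \sum_(2 <= i < n.+1) fps_exp g i n / i%:R.
  rewrite /fps_log -/g big_ltn // fps_exp1 divr1.
  rewrite [g n]/fps_sub /fps1 eqn0Ngt n0 sub0r; ring.
apply/bigON/bigO_sum => i; rewrite mem_index_iota => /andP[i1 _] _.
rewrite -[- _]addr0; apply: bigOM (bigO_natV _).
exact: bigO_fps_exp_ge2.
Qed.

(** * Möbius values and the coefficients of I *)

Lemma mobius1 : mobius 1 = 1.
Proof. by []. Qed.

Lemma mobius_prime p : prime p -> mobius p = -1.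
Proof.
move=> pP; rewrite /mobius prime_gt0 // primes_prime //=.
by rewrite logn_prime // eqxx.
Qed.

Lemma I_1 r : I_ r 1 = P_ r 1.
Proof.
rewrite /I_ big_nat1 mobius1 divr1 mul1r /fps_log big_nat1 divr1 fps_exp1.
by rewrite /fps_sub /fps1 dilate1 sub0r opprK.
Qed.

(** The summand k = 1 gives P_n up to this error. For k >= 2 the linear term is 0 or P_(n/k) with n
    / k <= n - 1, hence of degree at most d_(n-1). *)
Lemma bigO_I_sub_P r n : (0 < r)%N -> (0 < n)%N ->
  bigO_q (- (dimP r n.-1 + dimP r 1)%:Z) (I_ r n - P_ r n).
Proof.
move=> r0 n0; rewrite /I_ big_ltn // mobius1 divr1 mul1r addrAC.
apply: bigOD; first by have := bigO_log_dilate_P r0 (ltn0Sn 0) n0; rewrite dilate1.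
apply: bigO_sum => k; rewrite mem_index_iota => /andP[k1 _] _.
rewrite -[- _]add0r; apply: bigOM.
  by rewrite -[0]addr0; apply: bigOM (bigO_natV _); apply: bigO_int.
rewrite -[fps_log _ _](subrK (fps_dilate k (P_ r) n)); apply: bigOD.
  by apply: bigO_log_dilate_P => //; apply: ltnW.
rewrite /fps_dilate; case: ifP => _; last exact: bigO0.
apply: bigO_le (bigO_P _ _).
have h : (n %/ k <= n.-1)%N by have := ltn_Pdiv k1 n0; lia.
by have := dimP_le r0 h; lia.
Qed.

Lemma bigO_I r n : (0 < r)%N -> (0 < n)%N -> bigO_q (- (dimP r n)%:Z) (I_ r n).
Proof.
move=> r0 n0; rewrite -[I_ r n](subrK (P_ r n)); apply: bigOD (bigO_P _ _).
apply: bigO_le (bigO_I_sub_P r0 n0).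
by have := dimP_pred r0 n0; lia.
Qed.

(** * Divisor sums and the coefficients of E *)

Lemma big_divisors_prime p (F : nat -> Qq) : prime p ->
  \sum_(k <- divisors p) F k = F 1%N + F p.
Proof.
move=> pP; have p1 := prime_gt1 pP.
rewrite (perm_big [:: 1%N; p]) /=; first by rewrite !big_cons big_nil addr0.
apply: uniq_perm; rewrite ?divisors_uniq //= ?inE ?andbT; first by lia.
move=> k; rewrite -dvdn_divisors ?prime_gt0 // !inE.
apply/idP/pred2P => [kp|[->|->]]; rewrite ?dvd1n ?dvdnn //.
by have /primeP[_ /(_ _ kp)/pred2P] := pP.
Qed.

Definition A_term r n k : Qq :=
  k%:R^-1 * \sum_(s <- divisors k) (mobius s)%:~R * qsubst s (I_ r (n %/ k)%N).

Lemma A_term_prime r n p : prime p ->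
  A_term r n p = (I_ r (n %/ p)%N - qsubst p (I_ r (n %/ p)%N)) / p%:R.
Proof.
move=> pP; rewrite /A_term big_divisors_prime // mobius1 mobius_prime //.
by rewrite qsubst1 mul1r mulrN1z mulN1r mulrC.
Qed.

(** The divisor 1 contributes exactly I_n to A_n, which cancels. *)
Lemma E_E r n : (0 < n)%N ->
  E_ r n = - \sum_(k <- divisors n | k != 1%N) A_term r n k.
Proof.
move=> n0; rewrite /E_ /A_ eqn0Ngt n0 -/(A_term r n).
rewrite (bigD1_seq 1%N) ?divisors_uniq -?dvdn_divisors ?dvd1n //=.
rewrite big_seq1 mobius1 divn1 qsubst1 invr1 !mul1r opprD addNKr //.
Qed.

(** Every s dividing k is at most k, so I_(n/k)(q^s) has degree at most k d_(n/k). *)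
Lemma bigO_A_term r n k : (0 < r)%N -> (0 < n)%N -> (k %| n)%N ->
  bigO_q (- (k * dimP r (n %/ k))%:Z) (A_term r n k).
Proof.
move=> r0 n0 kn; have k0 := dvdn_gt0 n0 kn.
rewrite -[- _]add0r; apply: bigOM; first exact: bigO_natV.
apply: bigO_sum => s; rewrite -dvdn_divisors // => sk _.
rewrite -[- _]add0r; apply: bigOM; first exact: bigO_int.
have s0 := dvdn_gt0 k0 sk.
have nk0 : (0 < n %/ k)%N by rewrite divn_gt0 // dvdn_leq.
apply: bigO_le (bigO_qsubst s0 (bigO_I r0 nk0)).
by have := leq_mul (dvdn_leq k0 sk) (leqnn (dimP r (n %/ k))); lia.
Qed.

Lemma epsilonE r n (l := pdiv n) :
  epsilon r n = q ^+ (l * dimP r (n %/ l)) / (l%:R * (1 - q ^- l)).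
Proof.
by rewrite /epsilon -/l dimPz.
Qed.

(** No subtraction is truncated, since l >= 1 and r = c_1 <= c_m for m = n / l >= 1. *)
Lemma kappaE r n (l := pdiv n) : (0 < r)%N -> (0 < n %/ l)%N ->
  kappa r n = ((l - 1) * (nforms r (n %/ l) - r) + 1)%N.
Proof.
move=> r0 m0; rewrite /kappa -/l PoszD PoszM -!subzn ?pdiv_gt0 //.
by rewrite -[X in (X <= _)%N](nforms1 r0) nforms_le.
Qed.

(* Over an abstract field, because [field] diverges on the carrier [Qq]. *)
Lemma E_prime_identity (F : fieldType) (x y X Y Z W N : F) :
  Z != 0 -> W != 0 -> Y != 0 -> N != 0 -> y != 0 ->
  - ((x * X / Z - y * Y / W) / N) =
    y / (N * W) * Y * (1 - x / y * (X * W / (Z * Y))).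
Proof. by move=> Z0 W0 Y0 N0 y0; field; rewrite Z0 W0 Y0 N0 y0. Qed.

(** With epsilon = X / (N W), this solves E = epsilon (1 + f) for f, the approximation of E being
    epsilon (1 - Y). *)
Lemma epsilon_identity (F : fieldType) (E X Y N W : F) :
  W != 0 -> N != 0 -> X != 0 ->
  E = X / (N * W) * (1 + ((E - X * (1 - Y) / W / N) / (X / (N * W)) - Y)).
Proof. by move=> W0 N0 X0; field; rewrite W0 N0 X0. Qed.

(** For prime n only the divisor k = n remains, and I_1 = P_1 exactly, so E_n = (P_1(q^n) - P_1(q))
    / n. *)
Lemma E_prime r n : (0 < r)%N -> prime n ->
  E_ r n = epsilon r n * (1 - q ^- (n * r)) *
    (1 - q ^- (r * (n - 1)) *
         ((1 - q ^- r) * (1 - q ^- n) / ((1 - q^-1) * (1 - q ^- (n * r))))).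
Proof.
move=> r0 nP; have n0 := prime_gt0 nP.
have [z0 w0 y0] : [/\ 1 - q^-1 != 0, 1 - q ^- n != 0 & 1 - q ^- (n * r) != 0].
  split; [have := one_sub_qN_neq0 (ltn0Sn 0) | | ].
  - by rewrite expr1.
  - exact: one_sub_qN_neq0.
  - by apply: one_sub_qN_neq0; rewrite muln_gt0 n0.
have N0 := natQq_neq0 n0.
rewrite E_E // big_mkcond big_divisors_prime // eqxx add0r gtn_eqF ?prime_gt1 //.
rewrite [X in - X = _]/=.
rewrite A_term_prime // divnn n0 I_1 qsubst_P // P_E epsilonE pdiv_id //.
rewrite divnn n0 dimP1 // nforms1 // expr1.
have -> : q ^- (r * (n - 1)) = q ^+ r / q ^+ (n * r).
  have -> : (n * r = r * (n - 1) + r)%N by nia.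
  rewrite exprD; move: (expf_neq0 r q_neq0).
  by move: (q ^+ r) (q ^+ _) => x y x0; rewrite invfM mulrCA divff ?mulr1.
have y'0 := expf_neq0 (n * r) q_neq0.
(* Here x = q^r, y = q^(nr), and X, Y, Z, W are 1 - q^(-e) for e = r, nr, 1, n. *)
by rewrite (E_prime_identity (q ^+ r) (1 - q ^- r) z0 w0 y0 N0 y'0).
Qed.

(** Three errors arise: replacing I_m by P_m under the substitution of q^l, the summand s = 1 for k
    = l, and the divisors k > l. Each has degree at most l d_m - kappa. *)
Lemma E_composite r n (l := pdiv n) (m := (n %/ l)%N) :
  (1 < r)%N -> (1 < n)%N -> (1 < m)%N ->
  bigO_q (kappa r n - (l * dimP r m)%:Z) (E_ r n - qsubst l (P_ r m) / l%:R).
Proof.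
move=> r1 n1 m1; have r0 := ltnW r1; have n0 := ltnW n1.
have lP : prime l by apply: pdiv_prime.
have l1 := prime_gt1 lP; have l0 := ltnW l1.
have m0 := ltnW m1.
have cr : (r < nforms r m)%N by rewrite -{1}[r]nforms1 // nforms_lt.
have dm : dimP r m = (dimP r m.-1 + nforms r m)%N.
  by rewrite -{1 3}(prednK m0) dimPS.
have d1 : (r <= dimP r m.-1)%N by rewrite -{1}[r]dimP1 // dimP_le //; lia.
rewrite kappaE // -/l -/m; set kap := (_ + 1)%N.
have kapl : (kap <= l * (nforms r m - r))%N.
  rewrite /kap mulnBl mul1n; have := leq_mul l0 (leqnn (nforms r m - r)); lia.
rewrite E_E // -big_filter (bigD1_seq l) /=; first last.
- by rewrite filter_uniq ?divisors_uniq.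
- by rewrite mem_filter -dvdn_divisors // pdiv_dvd; lia.
rewrite A_term_prime // -/m.
set S := \sum_(_ <- _ | _) _.
have -> : - ((I_ r m - qsubst l (I_ r m)) / l%:R + S) - qsubst l (P_ r m) / l%:R
    = qsubst l (I_ r m - P_ r m) / l%:R - I_ r m / l%:R - S.
  have -> : qsubst l (I_ r m) = qsubst l (I_ r m - P_ r m) + qsubst l (P_ r m).
    by rewrite -qsubstD // subrK.
  ring.
apply: bigOB; first apply: bigOB.
(* The degree is at most l (d_(m-1) + r) = l d_m - l (c_m - r), and kappa <= l (c_m - r). *)
- rewrite -[X in bigO_q X]addr0; apply: bigOM (bigO_natV _).
  apply: bigO_le (bigO_qsubst l0 (bigO_I_sub_P r0 m0)).
  rewrite dm dimP1 // -/l; move: kapl; rewrite mulnBr.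
  have := leq_mul (leqnn l) (ltnW cr); rewrite mulrN !PoszD mulrDr -!PoszM.
  lia.
(* It suffices that kappa <= (l - 1) d_m, which follows from c_m - r < d_m and l > 1. *)
- rewrite -[X in bigO_q X]addr0; apply: bigOM (bigO_natV _).
  apply: bigO_le (bigO_I r0 m0).
  have h : (nforms r m - r < dimP r m)%N by lia.
  have := leq_mul (leqnn (l - 1)) (h : (_.+1 <= _)%N); rewrite mulnS /kap.
  have -> : (l * dimP r m = (l - 1) * dimP r m + dimP r m)%N.
    by rewrite mulnBl mul1n subnK // leq_pmull.
  lia.
apply: bigO_sum => k; rewrite mem_filter -dvdn_divisors // => /andP[k1 kn] kl.
apply: bigO_le (bigO_A_term r0 n0 kn).
have lk : (l < k)%N.
  have k0 := dvdn_gt0 n0 kn.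
  by rewrite ltn_neqAle eq_sym kl pdiv_min_dvd //; lia.
have := dimP_divisor_gap r1 n1 kn lk; rewrite -/l -/m /kap; lia.
Qed.

Theorem theorem6p4 (r n : nat) (hr : (2 <= r)%N) (hn : (2 <= n)%N) :
  [/\ E_ r 1 = 0,
      prime n ->
        E_ r n = epsilon r n * (1 - q ^- (n * r)) *
          (1 - q ^- (r * (n - 1)) *
               ((1 - q ^- r) * (1 - q ^- n) / ((1 - q^-1) * (1 - q ^- (n * r)))))
    & ~~ prime n ->
        2 <= kappa r n /\
        exists f : Qq, bigO_q (kappa r n) f /\ E_ r n = epsilon r n * (1 + f)].
Proof.
have r0 := ltnW hr; have n0 := ltnW hn; split.
(* The sum in [E_E] is empty, since 1 is the only divisor of 1. *)
- by rewrite E_E // big_cons big_nil /= oppr0.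
- exact: E_prime.
move=> nP; set l := pdiv n; pose m := (n %/ l)%N.
have lP : prime l by apply: pdiv_prime.
have l1 := prime_gt1 lP; have l0 := ltnW l1.
have ml : (m * l = n)%N by rewrite divnK // pdiv_dvd.
have m1 : (1 < m)%N.
  case: m ml => [|[|//]]; first by lia.
  by rewrite mul1n => ln; rewrite -ln lP in nP.
have cr : (r < nforms r m)%N by rewrite -{1}[r]nforms1 // nforms_lt.
split.
  rewrite kappaE -/l -/m ?(ltnW m1) //.
  have : (0 < (l - 1) * (nforms r m - r))%N by rewrite muln_gt0 !subn_gt0 l1.
  lia.
have W0 := one_sub_qN_neq0 l0; have N0 := natQq_neq0 l0.
have X0 := expf_neq0 (l * dimP r m) q_neq0.
(* Since P_m(q^l) / l = epsilon (1 - q^(-l c_m)), the relative error consists of the error in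
   [E_composite] divided by epsilon and of -q^(-l c_m). *)
exists ((E_ r n - qsubst l (P_ r m) / l%:R) / epsilon r n - q ^- (l * nforms r m)).
split; last first.
  rewrite epsilonE qsubst_P // -/l -/m.
  exact: (epsilon_identity (E_ r n) (q ^- (l * nforms r m)) W0 N0 X0).
apply: bigOB.
  (* Division by epsilon, of degree l d_m, leaves a bound of degree -kappa. *)
  have -> : kappa r n = kappa r n - (l * dimP r m)%:Z + (l * dimP r m)%:Z by ring.
  apply: bigOM; first exact: E_composite.
  rewrite epsilonE -/l -/m invf_div -[X in bigO_q X]add0r; apply: bigOM.
    by rewrite -[0]addr0; apply: bigOM; [apply: bigO_nat|apply: bigO_one_sub_qN].
  by rewrite exprnN; apply: bigO_le (bigO_qX _); rewrite opprK.
rewrite exprnN; apply: bigO_le (bigO_qX _).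
rewrite opprK kappaE -/l -/m ?(ltnW m1) // lez_nat.
by nia.
Qed.
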